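(* Let $\{\boldsymbol X_t\}_{t=0}^\infty$ be a weakly stationary $q$-dimensional process with spectral density matrix $f$, and let $\boldsymbol d_0=(d_1^0,\dots,d_q^0)'$ be the true fractional differencing vector. Let $\beta\in[0,1]$, let $B\subseteq\mathbb R^q$ be closed, and let $f_n$ be an $n^\beta$-consistent estimator of $f$ for all $\boldsymbol d_0\in B$, i.e. $n^\beta(f_n-f)\overset{\mathbb P}{\to}0$. Let $$\Omega_\beta:=\Big[-\frac{\beta}{2},0\Big]^q\cap\Big(-\frac12,0\Big]^q\cap B,\qquad \widehat{\boldsymbol d}:=\underset{\boldsymbol d\in\Omega_\beta}{\arg\min}\,S(\boldsymbol d),$$ where $S$ is the objective function based on $f_n$ given in the context. Assume that Assumptions A1–A4 (listed in the context) hold and that $\boldsymbol d_0\in\Omega_\beta$. Then $\widehat{\boldsymbol d}\overset{\mathbb P}{\to}\boldsymbol d_0$ as $n\to\infty$.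
   Context: **Spectral density.** $f=(f_{rs})_{r,s=1}^q$ is the spectral density matrix of $\{\boldsymbol X_t\}$: $\mathbb E[(\boldsymbol X_t-\mathbb E\boldsymbol X_t)(\boldsymbol X_{t+h}-\mathbb E\boldsymbol X_t)']=\int_{-\pi}^{\pi}e^{\mathrm i h\lambda}f(\lambda)\,d\lambda$. $G_0=(G_0^{rs})_{r,s=1}^q$ is a real, symmetric, positive definite matrix (the matrix appearing in A1). **Notation.** $M^*$ is the conjugate transpose of $M$; $(M)_{r\cdot}$ and $(M)_{\cdot s}$ are the $r$-th row and $s$-th column of $M$; $\|\cdot\|_\infty$ is the sup-norm. **Estimator.** $f_n$ is an estimator of $f$ based on the observations $\boldsymbol X_1,\dots,\boldsymbol X_n$; $\lambda_j:=2\pi j/n$ for $j=1,\dots,m$, where $m=m(n)=o(n)$. The objective function is $$S(\boldsymbol d):=\log\det\widehat G(\boldsymbol d)-2\sum_{k=1}^q d_k\frac1m\sum_{j=1}^m\log(\lambda_j),\qquad \widehat G(\boldsymbol d):=\frac1m\sum_{j=1}^m\mathrm{Re}\Big[\mathrm{diag}_{i}\{\lambda_j^{d_i}\}\,f_n(\lambda_j)\,\mathrm{diag}_{i}\{\lambda_j^{d_i}\}\Big],$$ with $\boldsymbol d=(d_1,\dots,d_q)'$ and $i$ ranging over $\{1,\dots,q\}$. **Assumptions.** A1. As $\lambda\to0^+$, $f_{rs}(\lambda)=e^{\mathrm i\pi(d_r^0-d_s^0)/2}G_0^{rs}\lambda^{-d_r^0-d_s^0}+o(\lambda^{-d_r^0-d_s^0})$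 for all $r,s=1,\dots,q$. A2. $\{\boldsymbol X_t\}$ is a causal linear process: $\boldsymbol X_t-\mathbb E(\boldsymbol X_t)=\sum_{k=0}^\infty A_k\boldsymbol\varepsilon_{t-k}$ with $\sum_{k=0}^\infty\|A_k\|_\infty^2<\infty$, where $\{\boldsymbol\varepsilon_t\}_{t\in\mathbb Z}$ is a square integrable martingale difference in the sense that $\mathbb E(\boldsymbol\varepsilon_t|\mathscr F_{t-1})=0$ and $\mathbb E(\boldsymbol\varepsilon_t\boldsymbol\varepsilon_t'|\mathscr F_{t-1})=\mathrm I_q$ a.s. for all $t\in\mathbb Z$, with $\mathscr F_t$ the $\sigma$-field generated by $\{\boldsymbol\varepsilon_s,s\le t\}$. Moreover there exist a random variable $\xi$ and a constant $K>0$ such that $\mathbb E(\xi^2)<\infty$ and $\mathbb P(\|\boldsymbol\varepsilon_t\|_\infty^2>\eta)\le K\,\mathbb P(\xi^2>\eta)$ for all $\eta>0$. A3. Let $A(\lambda):=\sum_{k=0}^\infty A_ke^{\mathrm ik\lambda}$. In a neighborhood $(0,\delta)$, $\delta>0$, of the origin, $A$ is differentiable and $\frac{\partial}{\partial\lambda}\big(A(\lambda)^*\big)_{r\cdot}=O\big(\lambda^{-1}\|(A(\lambda)^* )_{r\cdot}\|_\infty\big)$ as $\lambda\to0^+$ (for each $r$). A4. $\frac1m+\frac mn\to0$ as $n\to\infty$. *)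

(* Defs.v *)
From HB Require Import structures.
From mathcomp Require Import all_boot all_order all_algebra.
From mathcomp Require Import all_classical all_reals all_analysis.
From mathcomp Require Import complex.

Set Implicit Arguments.
Unset Strict Implicit.
Unset Printing Implicit Defensive.

Import Order.TTheory GRing.Theory Num.Theory.
Import numFieldNormedType.Exports.

Local Open Scope classical_set_scope.
Local Open Scope ring_scope.
Local Open Scope complex_scope.
Local Open Scope sesquilinear_scope.

(** Complex-valued functions of a real variable, handled componentwise. *)
Section ComplexFunctions.
Context {R : realType}.

Definition cexpi (x : R) : R[i] := cos x +i* sin x.

Definition cintegrable (D : set R) (g : R -> R[i]) : Prop :=
  (@lebesgue_measure R).-integrable D (fun x => (complex.Re (g x))%:E) /\
  (@lebesgue_measure R).-integrable D (fun x => (complex.Im (g x))%:E).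

Definition cintegral (D : set R) (g : R -> R[i]) : R[i] :=
  Rintegral (@lebesgue_measure R) D (fun x => complex.Re (g x)) +i*
  Rintegral (@lebesgue_measure R) D (fun x => complex.Im (g x)).

Definition cderivable (g : R -> R[i]) (x : R) : Prop :=
  derivable (fun y => complex.Re (g y)) x 1 /\
  derivable (fun y => complex.Im (g y)) x 1.

Definition cderive (g : R -> R[i]) (x : R) : R[i] :=
  derive1 (fun y => complex.Re (g y)) x +i*
  derive1 (fun y => complex.Im (g y)) x.

(* Largest modulus of an entry; [`|_|] on real matrices is the entrywise
   sup-norm. *)
Definition csup_norm {m n} (M : 'M[R[i]]_(m, n)) : R :=
  `|map_mx (@ComplexField.Normc.normc R) M|.

End ComplexFunctions.

Section Probability.
Context {disp : measure_display} {T : measurableType disp} {R : realType}.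
Variable P : probability T R.

(* [mu_ext P] is the outer measure of P, equal to P on measurable events.  It
   makes the definition meaningful for maps Y n not known to be measurable,
   such as argmins, and is the usual notion for random elements. *)
Definition cvg_in_probability {V : normedModType R} (Y : nat -> T -> V) (l : V)
    : Prop :=
  forall e : R, 0 < e ->
    mu_ext P [set w | e < `|Y n w - l|] @[n --> \oo] --> 0%E.

Definition square_integrable (Y : T -> R) : Prop :=
  P.-integrable setT (fun w => (Y w ^+ 2)%:E).

(* Y is a version of E(Z | G), for a sub-sigma-field G. *)
Definition is_cond_expectation (G : set (set T)) (Z Y : T -> R) : Prop :=
  [/\ P.-integrable setT (EFin \o Z),
      P.-integrable setT (EFin \o Y),
      forall B, measurable B -> G (Y @^-1` B) &
      forall A, G A ->
        (\int[P]_(w in A) (Z w)%:E = \int[P]_(w in A) (Y w)%:E)%E].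

End Probability.

Section Process.
Context {disp : measure_display} {T : measurableType disp} {R : realType}.
Variables (P : probability T R) (q : nat).

(* The random vector X_t is the family of its components (X t r)_r. *)
Definition weakly_stationary (X : nat -> 'I_q -> {RV P >-> R}) : Prop :=
  [/\ forall t r, square_integrable P (X t r),
      forall s t r, ('E_P[X s r] = 'E_P[X t r])%E &
      forall s t h r u,
        covariance P (X s r) (X (s + h)%N u) =
        covariance P (X t r) (X (t + h)%N u)].

(* The lag is h = t - s; s and t being arbitrary, h ranges over the integers. *)
Definition spectral_density (X : nat -> 'I_q -> {RV P >-> R})
    (f : R -> 'M[R[i]]_q) : Prop :=
  (forall r u, cintegrable `[- pi, pi] (fun l => f l r u)) /\
  (forall (s t : nat) r u,
     exists2 c : R, covariance P (X s r) (X t u) = c%:E &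
       c%:C = cintegral `[- pi, pi]
                (fun l => cexpi ((t%:R - s%:R) * l) * f l r u)).

Definition past_sigma_field (eps : int -> 'I_q -> {RV P >-> R}) (t : int)
    : set (set T) :=
  <<s [set A | exists s r (B : set R),
         [/\ s <= t, measurable B & A = eps s r @^-1` B]] >>.

Definition martingale_difference (eps : int -> 'I_q -> {RV P >-> R}) : Prop :=
  forall t,
    [/\ forall r, square_integrable P (eps t r),
        forall r, is_cond_expectation P (past_sigma_field eps (t - 1))
                    (eps t r) (cst 0) &
        forall r s, is_cond_expectation P (past_sigma_field eps (t - 1))
                    (fun w => eps t r w * eps t s w) (cst (1%:M r s))].

Definition uniform_tail_bound (eps : int -> 'I_q -> {RV P >-> R}) : Prop :=
  exists (xi : {RV P >-> R}) (K : R),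
    [/\ square_integrable P xi, 0 < K &
        forall t (eta : R), 0 < eta ->
          (P [set w | (eta < `|\row_r eps t r w| ^+ 2)%R]
             <= K%:E * P [set w | (eta < xi w ^+ 2)%R])%E].

(* The infinite moving average converges in mean square. *)
Definition causal_linear_process (X : nat -> 'I_q -> {RV P >-> R})
    (A : nat -> 'M[R]_q) (eps : int -> 'I_q -> {RV P >-> R}) : Prop :=
  cvgn (series (fun k => `|A k| ^+ 2)) /\
  forall t r,
    (\int[P]_w ((X t r w - fine 'E_P[X t r]
       - \sum_(0 <= k < N) \sum_(s < q) A k r s * eps (t%:Z - k%:Z)%R s w)
       ^+ 2)%:E)%E @[N --> \oo] --> 0%E.

Definition sample (X : nat -> 'I_q -> {RV P >-> R}) (n : nat) (w : T)
    : 'M[R]_(n, q) := \matrix_(i, r) X i.+1 r w.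

(* [n ^ beta (fn - f) --> 0] in probability, uniformly in the frequency:
   the supremum over ]0, pi] exceeds e iff the expression does at some l. *)
Definition rate_consistent (beta : R) (f : R -> 'M[R[i]]_q)
    (fn : nat -> T -> R -> 'M[R[i]]_q) : Prop :=
  forall e : R, 0 < e ->
    mu_ext P [set w | exists2 l, 0 < l <= pi &
                e < n%:R `^ beta * csup_norm (fn n w l - f l)]
      @[n --> \oo] --> 0%E.

End Process.

Section Assumptions.
Context {R : realType} {q : nat}.

Definition sym_posdef (G : 'M[R]_q) : Prop :=
  G^T = G /\ forall x : 'rV[R]_q, x != 0 -> 0 < (x *m G *m x^T) 0 0.

Definition assumption_A1 (f : R -> 'M[R[i]]_q) (G0 : 'M[R]_q) (d0 : 'rV[R]_q)
    : Prop :=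
  sym_posdef G0 /\
  forall r s,
    (fun l => @ComplexField.Normc.normc R
       (f l r s - cexpi (pi * (d0 0 r - d0 0 s) / 2)
                  * (G0 r s * l `^ (- d0 0 r - d0 0 s))%:C))
    =o_ (0^'+) (fun l => l `^ (- d0 0 r - d0 0 s)).

Definition assumption_A2 {disp} {T : measurableType disp} (P : probability T R)
    (X : nat -> 'I_q -> {RV P >-> R}) (A : nat -> 'M[R]_q)
    (eps : int -> 'I_q -> {RV P >-> R}) : Prop :=
  [/\ causal_linear_process X A eps,
      martingale_difference eps & uniform_tail_bound eps].

(* Partial sums of the real and imaginary parts of
   A(l) = sum_k A_k exp(i k l). *)
Definition transfer_re (A : nat -> 'M[R]_q) (l : R) (r s : 'I_q) : R ^nat :=
  series (fun k => A k r s * cos (k%:R * l)).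

Definition transfer_im (A : nat -> 'M[R]_q) (l : R) (r s : 'I_q) : R ^nat :=
  series (fun k => A k r s * sin (k%:R * l)).

Definition transfer (A : nat -> 'M[R]_q) (l : R) : 'M[R[i]]_q :=
  \matrix_(r, s) (limn (transfer_re A l r s) +i* limn (transfer_im A l r s)).

Definition assumption_A3 (A : nat -> 'M[R]_q) : Prop :=
  (exists2 delta : R, 0 < delta &
    forall l, 0 < l < delta -> forall r s,
      [/\ cvgn (transfer_re A l r s), cvgn (transfer_im A l r s) &
          cderivable (fun x => transfer A x r s) l]) /\
  forall r,
    (fun l => csup_norm (\row_s cderive (fun x => ((transfer A x)^t*) r s) l))
    =O_ (0^'+) (fun l => l^-1 * csup_norm (row r ((transfer A l)^t*))).

(* Positivity is part of the assumption because 0^-1 = 0. *)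
Definition assumption_A4 (m : nat -> nat) : Prop :=
  (\forall n \near \oo, (0 < m n)%N) /\
  (m n)%:R^-1 + (m n)%:R / n%:R @[n --> \oo] --> (0 : R).

End Assumptions.

Section Estimator.
Context {R : realType} {q : nat}.

Definition fourier_freq (n j : nat) : R := 2 * pi * j%:R / n%:R.

Definition freq_diag (l : R) (d : 'rV[R]_q) : 'M[R[i]]_q :=
  diag_mx (\row_i (l `^ d 0 i)%:C).

Definition Ghat (n m : nat) (fn : R -> 'M[R[i]]_q) (d : 'rV[R]_q) : 'M[R]_q :=
  m%:R^-1 *: \sum_(1 <= j < m.+1)
    map_mx (@complex.Re R)
      (freq_diag (fourier_freq n j) d *m fn (fourier_freq n j)
         *m freq_diag (fourier_freq n j) d).

(* [ln x = 0] for x <= 0; the logarithm is meant on the event where the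
   determinant is positive. *)
Definition objective (n m : nat) (fn : R -> 'M[R[i]]_q) (d : 'rV[R]_q) : R :=
  ln (\det (Ghat n m fn d))
  - 2 * \sum_(k < q)
      d 0 k * (m%:R^-1 * \sum_(1 <= j < m.+1) ln (fourier_freq n j)).

Definition Omega (beta : R) (B : set 'rV[R]_q) : set 'rV[R]_q :=
  [set d : 'rV[R]_q | forall i, - (beta / 2) <= d 0 i <= 0] `&`
  [set d : 'rV[R]_q | forall i, - (1 / 2) < d 0 i <= 0] `&` B.

Definition argmin {V : Type} (S : V -> R) (D : set V) : set V :=
  [set d | D d /\ forall d', D d' -> S d <= S d'].

End Estimator.

(* Main.v *)
Require Import Defs.
From HB Require Import structures.
From mathcomp Require Import all_boot all_order all_algebra.
From mathcomp Require Import all_classical all_reals all_analysis.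
From mathcomp Require Import complex.
From mathcomp Require Import perm ring lra zify.

Set Implicit Arguments.
Unset Strict Implicit.
Unset Printing Implicit Defensive.

Import Order.TTheory GRing.Theory Num.Theory.
Import numFieldNormedType.Exports.

Local Open Scope classical_set_scope.
Local Open Scope ring_scope.
Local Open Scope complex_scope.

(** Why consistency holds.  Write [theta = d - d0], let [l_j] be the Fourier
frequencies, [Lbar] the mean of the [ln l_j] over [j <= m] and
[z_j = ln l_j - Lbar].  Since [l_j `^ theta = exp (theta Lbar) exp (theta z_j)],
the matrix [Ghat d] is congruent, through the diagonal matrix of the
[exp (theta_r Lbar)], to the exponentially tilted mean

  [T theta r s = mean_j exp ((theta_r + theta_s) z_j) V_j r s],
  [V_j r s = l_j `^ (d0_r + d0_s) Re (fn (l_j) r s)].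

The determinant of the congruence is exactly what the linear term of the
objective compensates, so that, up to a constant, the objective is
[ln det (T theta)] ([Ghat_tilted_mean], [objective_potential]).

The behaviour of [f] at the origin, the rate of consistency and
[0 <= - (d0_r + d0_s) <= beta] make all the [V_j] uniformly close to
[W r s = G0 r s cos (pi (d0_r - d0_s) / 2)], which is positive definite
because it is the real part of the Hermitian matrix obtained from [G0] by a
diagonal unitary congruence ([sym_posdef_phase]).

It remains to bound [det (T theta)] from below.  Dividing entry [(r, s)] by
[sqrt (a_r a_s)], with [a_r = mean_j exp (2 theta_r z_j)], turns [T theta] into
a small perturbation of the entrywise product of [W] with a correlation matrix,
whose determinant is at least [det W] by Oppenheim's inequality
([oppenheim_gram]).  Hence [det (T theta)] is at least about
[det W * prod_r a_r].  The [z_j] have mean zero, so Jensen's inequality gives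
[a_r >= 1]; a fixed proportion of them is at least [1/8] ([log_spread]), so
[a_r] exceeds [1] by a fixed amount as soon as [theta_r] stays away from [0]
([mean_exp_ge]).  As [T 0] is close to [W], the objective is strictly larger
away from [d0] than at [d0] ([tilted_mean_det_separation]).  This estimate is
uniform over all [theta], including those for which [theta_r + theta_s]
approaches [-1] and the weights [(j / m) `^ (theta_r + theta_s)] cease to be
bounded in mean; it therefore also excludes minimizers close to the open side
[-1/2] of the parameter set.

All this takes place on an event whose complement has outer probability tending
to zero.  On it a minimizer over the compact part of the parameter set near
[d0] exists by continuity and is a global one, so that the argmin is not empty
and lies near [d0] ([argmin_near]). *)

(** * Schur complements and Oppenheim's inequality *)

(** The row [row_mx 1 x] eliminates the first row of [S]; the entry [s] left in
the corner is the Schur complement of the lower right block. *)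
Lemma schur_pivot (F : fieldType) n (S : 'M[F]_(1 + n)) :
    drsubmx S \in unitmx ->
  exists (x : 'rV[F]_n) (s : F),
    row_mx 1%:M x *m S = row_mx s%:M 0 /\ \det S = s * \det (drsubmx S).
Proof.
move=> uS; pose x : 'rV[F]_n := - (ursubmx S *m invmx (drsubmx S)).
have xS : row_mx 1%:M x *m S = row_mx ((ulsubmx S + x *m dlsubmx S) 0 0)%:M 0.
  rewrite -{1}[S]submxK mul_row_block !mul1mx -mx11_scalar; congr row_mx.
  by rewrite /x mulNmx -mulmxA mulVmx // mulmx1 subrr.
exists x, ((ulsubmx S + x *m dlsubmx S) 0 0); split=> //.
have : \det (block_mx 1%:M x 0 1%:M *m S) = \det S.
  by rewrite det_mulmx det_ublock !det1 !mul1r.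
move=> <-; rewrite /block_mx mul_col_mx xS -[S in row_mx 0 _ *m S]submxK.
rewrite mul_row_block !mul0mx !mul1mx !add0r -[col_mx _ _]/(block_mx _ _ _ _).
by rewrite det_lblock det_scalar1.
Qed.

Lemma sym_posdef_drsubmx (R : realType) n (S : 'M[R]_(1 + n)) :
  sym_posdef S -> sym_posdef (drsubmx S).
Proof.
case=> St Sp; split; first by rewrite trmx_drsub St.
move=> y y0.
have <- : row_mx 0 y *m S *m (row_mx 0 y)^T = y *m drsubmx S *m y^T.
  rewrite -[in LHS](submxK S) mul_row_block tr_row_mx mul_row_col !mul0mx.
  by rewrite !add0r trmx0 mulmx0 add0r.
apply: Sp; apply: contra y0 => /eqP.
by rewrite -[RHS]row_mx0 => /eq_row_mx[_ ->].
Qed.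

(** The pivot is the minimum of the quadratic form over the vectors with first
coordinate one: [row_mx 1 x] attains it, and is [S]-orthogonal to every vector
whose first coordinate vanishes. *)
Lemma sym_posdef_pivot (R : realType) n (S : 'M[R]_(1 + n)) (x : 'rV[R]_n) s :
    sym_posdef S -> row_mx 1%:M x *m S = row_mx s%:M 0 ->
  0 < s /\
  forall y : 'rV[R]_(1 + n), y 0 0 ^+ 2 * s <= (y *m S *m y^T) 0 0.
Proof.
move=> [St Sp] xS.
have lshift0 : lshift n (0 : 'I_1) = 0 by apply: val_inj.
have key (v : 'rV[R]_(1 + n)) :
    (row_mx 1%:M x *m S *m v^T) 0 0 = s * v 0 0.
  rewrite xS -{1}[v]hsubmxK tr_row_mx mul_row_col mul0mx addr0 mul_scalar_mx.
  by rewrite !mxE lshift0.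
have x1 : (row_mx 1%:M x : 'rV[R]_(1 + n)) 0 0 = 1.
  by rewrite -[X in _ 0 X]lshift0 row_mxEl mxE eqxx.
split.
  have := Sp (row_mx 1%:M x); rewrite key x1 mulr1; apply.
  by apply/eqP => /(congr1 (fun v : 'rV_(1 + n) => v 0 0));
  rewrite x1 mxE => /eqP; rewrite oner_eq0.
move=> y; pose w := y - y 0 0 *: row_mx 1%:M x.
have w0 : w 0 0 = 0.
  by rewrite [w 0 0]mxE [X in _ + X]mxE [X in - X]mxE x1 mulr1 subrr.
have -> : y = y 0 0 *: row_mx 1%:M x + w by rewrite /w addrC subrK.
set a := y 0 0; set X := row_mx 1%:M x.
have wX : (w *m S *m X^T) 0 0 = 0.
  have -> : w *m S *m X^T = (X *m S *m w^T)^T.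
    by rewrite !trmx_mul trmxK St mulmxA.
  by rewrite mxE key w0 mulr0.
have ww : 0 <= (w *m S *m w^T) 0 0.
  have [->|/Sp/ltW//] := eqVneq w 0.
  by rewrite !mul0mx mxE.
have Xw : (X *m S *m w^T) 0 0 = 0 by rewrite key w0 mulr0.
have XX : (X *m S *m X^T) 0 0 = s by rewrite key x1 mulr1.
have -> : (((a *: X + w) *m S *m (a *: X + w)^T) 0 0) =
    a ^+ 2 * (X *m S *m X^T) 0 0 + a * (X *m S *m w^T) 0 0
     + a * (w *m S *m X^T) 0 0 + (w *m S *m w^T) 0 0.
  have -> : (a *: X + w)^T = a *: X^T + w^T by rewrite linearD linearZ.
  rewrite !mulmxDl !mulmxDr -!scalemxAl -!scalemxAr scalerA.
  have addE (U V : 'M[R]_1) : (U + V) 0 0 = U 0 0 + V 0 0 by rewrite mxE.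
  have scaleE c (V : 'M[R]_1) : (c *: V) 0 0 = c * V 0 0 by rewrite mxE.
  by rewrite !(addE, scaleE); ring.
have -> : (a *: X + w) 0 0 = a.
  by rewrite [LHS]mxE w0 addr0 [LHS]mxE x1 mulr1.
by rewrite Xw wX XX !mulr0 !addr0 lerDl.
Qed.

Lemma sym_posdef_det_gt0 (R : realType) n (S : 'M[R]_n) :
  sym_posdef S -> 0 < \det S.
Proof.
elim: n S => [|n IH] S Sp; first by rewrite det_mx00.
have Sp' := IH _ (@sym_posdef_drsubmx _ n S Sp).
have [|x [s [xS ->]]] := @schur_pivot R n S.
  by rewrite unitmxE unitfE gt_eqF.
by have [s0 _] := sym_posdef_pivot Sp xS; rewrite mulr_gt0.
Qed.

(** Oppenheim's inequality for the entrywise product of [W] with a correlation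
matrix, here presented as the Gram matrix of unit vectors.  By induction on the
dimension it suffices to compare pivots, and the pivot is a minimum of the
quadratic form: at any vector with first coordinate one, the form of the product
is the sum over [j] of the form of [W] at vectors with first coordinate
[u j 0], hence at least the pivot of [W] times the sum of the [u j 0 ^+ 2]. *)
Lemma oppenheim_gram (R : realType) (J : finType) n (W : 'M[R]_n)
    (u : J -> 'I_n -> R) :
    sym_posdef W -> (forall r, \sum_j u j r ^+ 2 = 1) ->
  \det W <= \det (\matrix_(r, s) \sum_j u j r * u j s * W r s).
Proof.
elim: n W u => [|n IH] W u Wp u1; first by rewrite !det_mx00.
pose M : 'M[R]_(1 + n) := \matrix_(r, s) \sum_j u j r * u j s * W r s.
rewrite -[X in _ <= \det X]/M.
have Wp' := @sym_posdef_drsubmx _ n W Wp.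
have dW' := sym_posdef_det_gt0 Wp'.
have MW' : \det (@drsubmx _ 1 n 1 n W) <= \det (drsubmx M).
  apply: le_trans (IH _ (fun j r => u j (@rshift 1 n r)) Wp' _) _; last first.
    rewrite le_eqVlt; apply/orP; left; apply/eqP; congr (\det _).
    apply/matrixP => r s; rewrite !mxE.
    by apply: eq_bigr.
  by move=> r; apply: u1.
have [|x [s [xW dW]]] := @schur_pivot R n W.
  by rewrite unitmxE unitfE gt_eqF.
have [s0 sP] := sym_posdef_pivot Wp xW.
have [|y [t [yM dM]]] := @schur_pivot R n M.
  by rewrite unitmxE unitfE gt_eqF // (lt_le_trans dW').
rewrite dW dM; apply: ler_pM => //; [exact: ltW|exact: ltW|].
pose Y : 'rV[R]_(1 + n) := row_mx 1%:M y.
have lshift0 : lshift n (0 : 'I_1) = 0 by apply: val_inj.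
have Y0 : Y 0 0 = 1 by rewrite /Y -[X in _ 0 X]lshift0 row_mxEl mxE eqxx.
have <- : (Y *m M *m Y^T) 0 0 = t.
  by rewrite /Y yM tr_row_mx mul_row_col mul0mx addr0 trmx1 mulmx1 mxE eqxx.
pose v j : 'rV[R]_(1 + n) := \row_r (Y 0 r * u j r).
have -> : (Y *m M *m Y^T) 0 0 = \sum_j (v j *m W *m (v j)^T) 0 0.
  rewrite mxE.
  under [in RHS]eq_bigr do rewrite mxE.
  rewrite exchange_big; apply: eq_bigr => b _; rewrite [Y^T _ _]mxE mxE mulr_suml.
  under [in RHS]eq_bigr do rewrite mxE mulr_suml.
  rewrite exchange_big; apply: eq_bigr => a _.
  rewrite [M a b]mxE mulr_sumr mulr_suml.
  apply: eq_bigr => j _.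
  by rewrite [(v j)^T b 0]mxE [v j 0 a]mxE [v j 0 b]mxE; ring.
have -> : s = \sum_j (v j 0 0) ^+ 2 * s.
  rewrite -mulr_suml; under eq_bigr do rewrite [v _ 0 0]mxE Y0 mul1r.
  by rewrite u1 mul1r.
by apply: ler_sum => j _; apply: sP.
Qed.

(** * Perturbation of determinants *)

Lemma prod_lipschitz (R : realFieldType) (I : Type) (s : seq I) (a b : I -> R)
    (C eta : R) :
    1 <= C -> (forall i, `|a i| <= C) -> (forall i, `|b i| <= C) ->
    (forall i, `|a i - b i| <= eta) ->
  `|\prod_(i <- s) a i - \prod_(i <- s) b i|
    <= (size s)%:R * C ^+ size s * eta.
Proof.
move=> C1 aC bC ab; have C0 : 0 <= C := le_trans ler01 C1.
elim: s => [|i s IH]; first by rewrite !big_nil subrr normr0 !mul0r.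
rewrite !big_cons /=.
have eta0 : 0 <= eta := le_trans (normr_ge0 _) (ab i).
have bP : `|\prod_(j <- s) b j| <= C ^+ size s.
  elim: s {IH} => [|j s IH]; first by rewrite big_nil normr1.
  by rewrite big_cons normrM exprS ler_pM.
set X := \prod_(j <- s) a j in IH *; set Y := \prod_(j <- s) b j in IH bP *.
have -> : a i * X - b i * Y = a i * (X - Y) + (a i - b i) * Y by ring.
apply: le_trans (ler_normD _ _) _; rewrite !normrM.
have h1 : `|a i| * `|X - Y| <= C * ((size s)%:R * C ^+ size s * eta).
  by rewrite ler_pM.
have h2 : `|a i - b i| * `|Y| <= eta * (C * C ^+ size s).
  by rewrite ler_pM // (le_trans bP) // ler_peMl // exprn_ge0.
by rewrite -natr1 exprS; lra.
Qed.

Lemma det_lipschitz (R : realFieldType) n (C : R) : 1 <= C ->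
  exists2 K : R, 0 < K & forall (A B : 'M[R]_n) (eta : R),
    (forall r s, `|A r s| <= C) -> (forall r s, `|B r s| <= C) ->
    (forall r s, `|A r s - B r s| <= eta) -> 0 <= eta ->
    `|\det A - \det B| <= K * eta.
Proof.
move=> C1; have C0 : 0 <= C := le_trans ler01 C1.
exists (1 + \sum_(p : 'S_n) n%:R * C ^+ n).
  by rewrite ltr_wpDr // sumr_ge0 // => p _; rewrite mulr_ge0 ?exprn_ge0.
move=> A B eta AC BC AB eta0; rewrite /determinant -sumrB.
apply: le_trans (ler_norm_sum _ _ _) _; rewrite mulrDl mul1r mulr_suml.
rewrite -[leLHS]add0r lerD //; apply: ler_sum => p _.
rewrite -mulrBr normrM normrX normrN1 expr1n mul1r.
have := @prod_lipschitz R _ (index_enum 'I_n) (fun i => A i (p i))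
  (fun i => B i (p i)) _ _ C1 (fun=> AC _ _) (fun=> BC _ _) (fun=> AB _ _).
have -> : size (index_enum 'I_n) = n.
  by rewrite -[RHS]card_ord cardT enumT.
by [].
Qed.

Lemma det_congruence (R : comNzRingType) n (a : 'I_n -> R) (N : 'M[R]_n) :
  \det (\matrix_(r, s) (a r * N r s * a s)) = (\prod_r a r) ^+ 2 * \det N.
Proof.
have -> : (\matrix_(r, s) (a r * N r s * a s)) =
    diag_mx (\row_r a r) *m N *m diag_mx (\row_r a r).
  by apply/matrixP => r s; rewrite mul_mx_diag mul_diag_mx !mxE.
rewrite !det_mulmx det_diag; under eq_bigr do rewrite mxE.
by rewrite expr2; ring.
Qed.

(** * Exponential moments of centered logarithms *)

(** The gap in the inequality [1 + x <= exp x]: for a mean zero family [z] it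
measures by how much the mean of [exp z] exceeds one. *)
Definition exp_gap (R : realType) (x : R) : R := expR x - 1 - x.

Lemma exp_gap_ge0 (R : realType) (x : R) : 0 <= exp_gap x.
Proof. by rewrite /exp_gap; have := expR_ge1Dx x; lra. Qed.

Lemma exp_gap_gt0 (R : realType) (x : R) : x != 0 -> 0 < exp_gap x.
Proof. by rewrite /exp_gap => /expR_gt1Dx; lra. Qed.

(** By convexity, [exp_gap] having its minimum at the origin: the sign condition
says that [b] points away from it. *)
Lemma le_exp_gap (R : realType) (a b : R) :
  0 <= a * b -> exp_gap a <= exp_gap (a + b).
Proof.
move=> ab; have b_exp : 0 <= b * (expR a - 1).
  have := expR_ge1Dx a; have [b0|b0] := ltP 0 b; first by nra.
  have [->|bn] := eqVneq b 0; first by rewrite mul0r.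
  have a0 : a <= 0 by have : b < 0; [rewrite lt_neqAle bn|nra].
  by rewrite -expR_le1 in a0; nra.
rewrite /exp_gap expRD.
have : expR a * (1 + b) <= expR a * expR b.
  by rewrite ler_pM2l ?expR_gt0 // expR_ge1Dx.
by lra.
Qed.

Lemma le_exp_gap_norm (R : realType) (e x : R) : 0 < e -> e <= `|x| ->
  Num.min (exp_gap e) (exp_gap (- e)) <= exp_gap x.
Proof.
move=> e0 ex; rewrite ge_min; have [x0|x0] := ltP 0 x.
  rewrite gtr0_norm // in ex.
  by have /le_exp_gap : 0 <= e * (x - e); [nra|rewrite addrC subrK => ->].
rewrite ler0_norm // in ex.
have /le_exp_gap : 0 <= - e * (x + e) by nra.
by rewrite [- e + _]addrC addrK => ->; rewrite orbT.
Qed.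

(** Jensen's inequality with a remainder: the terms of index outside [U] only
contribute nonnegatively, and those in [U] contribute at least the gap at
[t * c], whatever the sign of [t]. *)
Lemma mean_exp_ge (R : realType) (J : finType) (U : {set J}) (z : J -> R)
    (c t : R) :
    \sum_j z j = 0 -> 0 < c -> (forall j, j \in U -> c <= z j) ->
  #|J|%:R + #|U|%:R * exp_gap (t * c) <= \sum_j expR (t * z j).
Proof.
move=> z0 c0 Uz.
have -> : \sum_j expR (t * z j) = #|J|%:R + \sum_j exp_gap (t * z j).
  rewrite /exp_gap !sumrB -mulr_sumr z0 mulr0 subr0 sumr_const.
  by rewrite addrC subrK.
rewrite lerD2l (bigID (mem U)) /= -[leLHS]addr0 lerD //; last first.
  by apply: sumr_ge0 => j _; apply: exp_gap_ge0.
rewrite mulr_natl -sumr_const; apply: ler_sum => j /Uz cz.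
have -> : t * z j = t * c + t * (z j - c) by ring.
by apply: le_exp_gap; nra.
Qed.

(** The logarithms of an arithmetic progression are not concentrated around
their mean.  Relative to the last one they are at most [j / m - 1], of mean at
most [-1/4], whereas the last ninth of them are at least [-1/8]. *)
Lemma log_spread (R : realType) (m : nat) (c : R) : (1 < m)%N -> 0 < c ->
  let L (j : 'I_m) : R := ln (c * j.+1%:R) in
  let Lbar := m%:R^-1 * \sum_j L j in
  exists U : {set 'I_m}, (m <= 9 * #|U|)%N /\
    forall j, j \in U -> 1 / 8 <= L j - Lbar.
Proof.
move=> m1 c0 L Lbar; have m0 : 0 < (m%:R : R) by rewrite ltr0n; lia.
have jm (j : 'I_m) : 0 < (j.+1%:R / m%:R : R) by rewrite divr_gt0 // ltr0n.
have LE j : L j = ln (c * m%:R) + ln (j.+1%:R / m%:R).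
  rewrite /L -lnM ?posrE ?jm ?mulr_gt0 //; congr ln.
  by field; rewrite gt_eqF.
have Lbar_le : Lbar <= ln (c * m%:R) - 1 / 4.
  have : \sum_j L j <= \sum_(j < m) (ln (c * m%:R) - 1 + m%:R^-1 * j.+1%:R).
    apply: ler_sum => j _; rewrite LE -addrA lerD2l.
    have := @le_ln1Dx R (j.+1%:R / m%:R - 1).
    by rewrite ltrBrDl subrr jm [1 + _]addrC subrK => /(_ isT); lra.
  rewrite big_split /= sumr_const card_ord -mulr_sumr -natr_sum.
  have -> : (\sum_(j < m) j.+1 = (m.+1 * m)./2)%N.
    rewrite -[RHS](@bin2 m.+1) -bin2_sum big_mkord big_ord_recl /= add0n.
    by apply: eq_bigr.
  have -> : ((m.+1 * m)./2%:R : R) = m%:R * (m%:R + 1) / 2.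
    have : ((m.+1 * m)./2 * 2 = m.+1 * m)%N.
      have := odd_double_half (m.+1 * m); rewrite oddM oddS andNb add0n.
      by rewrite muln2.
    by move=> /(congr1 (fun k => k%:R : R)); rewrite !natrM -[m.+1%:R]natr1; lra.
  rewrite -mulrA mulKf ?gt_eqF // -mulr_natl => sumL.
  rewrite /Lbar mulrC ler_pdivrMr //.
  have : 2 <= (m%:R : R) by rewrite ler_nat.
  set M := m%:R in sumL *; set l := ln _ in sumL *.
  by nra.
exists [set j : 'I_m | (8 * m <= 9 * j.+1)%N]%SET; split.
  (* the largest indices, as many as m / 9 rounded up *)
  have km : ((m + 8) %/ 9 <= m)%N by lia.
  pose g (i : 'I_((m + 8) %/ 9)) : 'I_m := rev_ord (widen_ord km i).
  have g_inj : injective g.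
    by move=> i i' /rev_ord_inj /(congr1 val) /= /val_inj.
  have : (#|(g @: [set: 'I_((m + 8) %/ 9)])%SET|
           <= #|[set j : 'I_m | (8 * m <= 9 * j.+1)%N]%SET|)%N.
    apply/subset_leq_card/fintype.subsetP => _ /imsetP[i _ ->]; rewrite inE /=.
    by have := ltn_ord i; lia.
  rewrite card_imset // cardsT card_ord => kU.
  by apply: leq_trans (leq_mul (leqnn 9) kU); lia.
move=> j; rewrite inE => jm8.
have r : 0 < (m%:R / j.+1%:R : R) by rewrite divr_gt0 // ltr0n.
have : m%:R / j.+1%:R <= 9 / 8 :> R.
  rewrite ler_pdivrMr ?ltr0n //.
  have : (8 * m)%:R <= (9 * j.+1)%:R :> R by rewrite ler_nat.
  by rewrite !natrM; lra.
have : ln (j.+1%:R / m%:R) = - ln (m%:R / j.+1%:R) :> R.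
  by rewrite -lnV ?posrE // invf_div.
have := @le_ln1Dx R (m%:R / j.+1%:R - 1).
rewrite ltrBrDl subrr r [1 + _]addrC subrK => /(_ isT).
rewrite LE; move: (m%:R / _) => y; move: Lbar_le.
move: (ln _) (ln y) (ln _) Lbar => ? ? ? ?; lra.
Qed.

(** * Tilted means of nearly constant matrices *)

(** The matrix [Ghat] up to the scale of the frequencies: [z j] stands for the
centered logarithm of the [j]-th one. *)
Definition tilted_mean (R : realType) (J : finType) n (z : J -> R)
    (V : J -> 'M[R]_n) (theta : 'rV[R]_n) : 'M[R]_n :=
  \matrix_(r, s) (#|J|%:R^-1 *
    \sum_j expR ((theta 0 r + theta 0 s) * z j) * V j r s).

Lemma continuous_tilted_mean_det (R : realType) (J : finType) n (z : J -> R)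
    (V : J -> 'M[R]_n) :
  continuous (fun theta => \det (tilted_mean z V theta)).
Proof.
have contM (g h : 'rV[R]_n -> R) : continuous g -> continuous h ->
    continuous (fun x => g x * h x).
  by move=> cg ch x; exact: (continuousM (cg x) (ch x)).
have contcst (k : R) : continuous (fun _ : 'rV[R]_n => k).
  by move=> x; exact: cst_continuous.
have entry r s : continuous (fun theta => tilted_mean z V theta r s).
  have -> : (fun theta => tilted_mean z V theta r s) = (fun theta =>
      #|J|%:R^-1 * \sum_j expR ((theta 0 r + theta 0 s) * z j) * V j r s).
    by apply/funext => theta; rewrite mxE.
  apply: (contM _ _) => //; apply: continuous_big => [|j ?].
    exact: add_continuous.
  apply: (contM _ _) => //.
  have expo : continuous (fun theta : 'rV[R]_n =>
      (theta 0 r + theta 0 s) * z j).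
    apply: (contM _ _) => // x; apply: (@continuousD _ _ _ (fun t : 'rV[R]_n => t 0 r)
      (fun t : 'rV[R]_n => t 0 s)); exact: coord_continuous.
  by move=> x; exact: (continuous_comp (expo x) (@continuous_expR R _)).
apply: continuous_big => [|p ?]; first exact: add_continuous.
apply: (contM _ _) => //.
by apply: continuous_big => [|i ?]; [exact: mul_continuous|exact: entry].
Qed.

(** Up to the diagonal scaling by [a r], a tilted mean is an average with weights
[u j r * u j s], which neither amplify the errors on the entries nor, by
Oppenheim's inequality, lower the determinant.  The scaling multiplies the
determinant by the product of the [a r], all at least one, and one of them
bounded away from one when [theta] is away from the origin.  The proportion
[1/9] and the height [1/8] of the large [z j] are those of [log_spread]; any
positive constants would do. *)
Lemma tilted_mean_det_separation (R : realType) n (W : 'M[R]_n) (e : R) :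
    sym_posdef W -> 0 < e ->
  exists2 eta : R, 0 < eta &
    forall (J : finType) (z : J -> R) (U : {set J}) (V : J -> 'M[R]_n),
      (0 < #|J|)%N -> \sum_j z j = 0 ->
      (#|J| <= 9 * #|U|)%N -> (forall j, j \in U -> 1 / 8 <= z j) ->
      (forall j r s, `|V j r s - W r s| <= eta) ->
    (forall theta : 'rV[R]_n, 0 < \det (tilted_mean z V theta)) /\
    (forall (theta : 'rV[R]_n) r, e <= `|theta 0 r| ->
       \det (tilted_mean z V 0) < \det (tilted_mean z V theta)).
Proof.
move=> Wp e0; set D := \det W.
have D0 : 0 < D := sym_posdef_det_gt0 Wp.
have [kappa kappa0 kappaP] : exists2 kappa : R, 0 < kappa &
    forall x, e / 4 <= `|x| -> kappa <= exp_gap x / 9.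
  exists (Num.min (exp_gap (e / 4)) (exp_gap (- (e / 4))) / 9).
    by rewrite divr_gt0 // lt_min !exp_gap_gt0 // ?oppr_eq0 gt_eqF // divr_gt0.
  by move=> x ex; rewrite ler_pM2r ?invr_gt0 // le_exp_gap_norm // divr_gt0.
have [w w0 Ww] : exists2 w : R, 0 <= w & forall r s, `|W r s| <= w.
  exists `|W|; first exact: normr_ge0.
  by move=> r s; rewrite [leRHS]/Num.norm /= mx_normrE (le_bigmax _ _ (r, s)).
pose C : R := w + 2.
have WC r s : `|W r s| <= C - 1 by have := Ww r s; rewrite /C; lra.
have C1 : 1 <= C by rewrite /C; lra.
have [K K0 KP] := det_lipschitz n C1.
(* chosen so that (1 + kappa) (D - delta) exceeds D + delta *)
pose delta := kappa * D / (3 + kappa).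
have delta0 : 0 < delta by apply: divr_gt0; [exact: mulr_gt0|lra].
have deltaE : delta * (3 + kappa) = kappa * D by rewrite divfK // gt_eqF; lra.
exists (Num.min 1 (delta / K)); first by rewrite lt_min ltr01 divr_gt0.
move=> J z U V J0 z0 JU Uz; set eta := Num.min _ _ => VW.
have eta0 : 0 < eta by rewrite lt_min ltr01 divr_gt0.
have eta1 : eta <= 1 by rewrite ge_min lexx.
have Keta : K * eta <= delta by rewrite mulrC -ler_pdivlMr // ge_min lexx orbT.
have n0 : 0 < #|J|%:R :> R by rewrite ltr0n.
(* as |u j r * u j s| sums to at most one, entrywise errors are averaged *)
have pert (u : J -> 'I_n -> R) : (forall r, \sum_j u j r ^+ 2 = 1) ->
    `|\det (\matrix_(r, s) \sum_j u j r * u j s * V j r s) -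
      \det (\matrix_(r, s) \sum_j u j r * u j s * W r s)| <= delta.
  move=> u1; have uu r s : \sum_j `|u j r * u j s| <= 1.
    have -> : 1 = \sum_j (u j r ^+ 2 + u j s ^+ 2) / 2 :> R.
      by rewrite -mulr_suml big_split /= !u1; field.
    apply: ler_sum => j _; rewrite normrM -(real_normK (num_real (u j r))).
    rewrite -(real_normK (num_real (u j s))).
    by have := sqr_ge0 (`|u j r| - `|u j s|); nra.
  have bd (g : J -> R) r s c : (forall j, `|g j| <= c) -> 0 <= c ->
      `|\sum_j u j r * u j s * g j| <= c.
    move=> gc c0; apply: le_trans (ler_norm_sum _ _ _) _.
    apply: (@le_trans _ _ (\sum_j `|u j r * u j s| * c)).
      by apply: ler_sum => j _; rewrite normrM ler_pM.
    by rewrite -mulr_suml ler_piMl.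
  apply: le_trans Keta; apply: KP => [r s|r s|r s|]; last exact: ltW.
  - rewrite mxE bd // => [j|]; last by lra.
    have -> : V j r s = (V j r s - W r s) + W r s by rewrite subrK.
    apply: le_trans (ler_normD _ _) _.
    by have := VW j r s; have := WC r s; lra.
  - by rewrite mxE bd // => [j|]; [have := WC r s|]; lra.
  - rewrite !mxE -sumrB; under eq_bigr do rewrite -mulrBr.
    by rewrite bd // ltW.
have tilt0 : \det (tilted_mean z V 0) <= D + delta.
  pose u (j : J) (r : 'I_n) : R := Num.sqrt (#|J|%:R^-1).
  have uu j r s : u j r * u j s = #|J|%:R^-1.
    by rewrite /u -expr2 sqr_sqrtr // invr_ge0 ltW.
  have u1 r : \sum_j u j r ^+ 2 = 1.
    under eq_bigr do rewrite expr2 uu.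
    by rewrite sumr_const -[LHS]mulr_natl divff // gt_eqF.
  have := pert u u1.
  have -> : \matrix_(r, s) (\sum_j u j r * u j s * V j r s) = tilted_mean z V 0.
    apply/matrixP => r s; rewrite !mxE mulr_sumr; apply: eq_bigr => j _.
    by rewrite uu addr0 mul0r expR0 mul1r.
  have -> : \matrix_(r, s) (\sum_j u j r * u j s * W r s) = W.
    apply/matrixP => r s; rewrite mxE -mulr_suml.
    under eq_bigr => j _ do rewrite uu -(uu j r r) -expr2.
    by rewrite u1 mul1r.
  by rewrite ler_norml -/D; lra.
pose a (theta : 'rV[R]_n) r : R :=
  (\sum_j expR (2 * theta 0 r * z j)) / #|J|%:R.
have a_ge (theta : 'rV[R]_n) r : 1 + exp_gap (theta 0 r / 4) / 9 <= a theta r.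
  have := @mean_exp_ge R J U z (1 / 8) (2 * theta 0 r) z0 _ Uz.
  have -> : 2 * theta 0 r * (1 / 8) = theta 0 r / 4 by field.
  move=> /(_ _) h; rewrite ler_pdivlMr //; apply: le_trans (h _); last by lra.
  rewrite mulrDl mul1r lerD2l mulrAC ler_pdivrMr // mulrAC mulrC.
  rewrite ler_wpM2r ?exp_gap_ge0 //.
  by move: JU; rewrite -(ler_nat R) natrM mulrC.
have a_ge1 (theta : 'rV[R]_n) r : 1 <= a theta r.
  by apply: le_trans (a_ge _ _); rewrite lerDl divr_ge0 ?exp_gap_ge0.
have tilt (theta : 'rV[R]_n) :
    (\prod_r a theta r) * (D - delta) <= \det (tilted_mean z V theta).
  have a0 r : 0 < a theta r := lt_le_trans ltr01 (a_ge1 _ _).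
  (* u normalises the tilting weights; al undoes the normalisation *)
  pose al r := Num.sqrt (a theta r); pose k : R := Num.sqrt #|J|%:R.
  have al2 r : al r ^+ 2 = a theta r by rewrite sqr_sqrtr // ltW.
  have al0 r : al r != 0 by rewrite gt_eqF // sqrtr_gt0.
  have k2 : k ^+ 2 = #|J|%:R by rewrite sqr_sqrtr // ltW.
  have k0 : k != 0 by rewrite gt_eqF // sqrtr_gt0.
  pose u j r := expR (theta 0 r * z j) / (k * al r).
  have u1 r : \sum_j u j r ^+ 2 = 1.
    under eq_bigr do rewrite /u expr_div_n -expRM_natl exprMn al2 k2 mulrA.
    rewrite -mulr_suml.
    have -> : \sum_j expR (2 * theta 0 r * z j) = #|J|%:R * a theta r.
      by rewrite [RHS]mulrC divfK // gt_eqF.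
    by rewrite divff // mulf_neq0 // gt_eqF.
  have -> : tilted_mean z V theta = \matrix_(r, s)
      (al r * (\matrix_(r, s) \sum_j u j r * u j s * V j r s) r s * al s).
    apply/matrixP => r s; rewrite !mxE !mulr_sumr mulr_suml.
    apply: eq_bigr => j _; rewrite /u mulrDl expRD -k2.
    by field; rewrite k0 !al0.
  rewrite det_congruence -prodrXl; under [in leRHS]eq_bigr do rewrite al2.
  rewrite ler_wpM2l ?prodr_ge0 // => [r _|]; first exact: ltW.
  have := pert u u1; have := oppenheim_gram Wp u1.
  by rewrite ler_norml -/D; lra.
have prod1 (theta : 'rV[R]_n) Q : 1 <= \prod_(r | Q r) a theta r.
  by apply: (big_ind (fun x => 1 <= x)) => // x y; exact: mulr_ege1.
have deltaD : delta < D by nra.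
split=> [theta|theta r er].
  apply: lt_le_trans (tilt _).
  by rewrite mulr_gt0 ?subr_gt0 // (lt_le_trans ltr01 (prod1 _ _)).
apply: le_lt_trans tilt0 _; apply: lt_le_trans (tilt _).
have : 1 + kappa <= \prod_r a theta r.
  rewrite (bigD1 r) //= -[leLHS]mulr1; apply: ler_pM => //; first by lra.
  apply: le_trans (a_ge _ _); rewrite lerD2l; apply: kappaP.
  by rewrite normrM [`|4^-1|]gtr0_norm; lra.
by nra.
Qed.

(** * The objective function *)

(** This matrix is the real part of [D G D^*] with [D] the diagonal matrix of the
[exp (i phi r)]; its form at [x] is the sum of the forms of [G] at the real and
imaginary parts of [x D]. *)
Lemma sym_posdef_phase (R : realType) n (G : 'M[R]_n) (phi : 'I_n -> R) :
  sym_posdef G -> sym_posdef (\matrix_(r, s) (G r s * cos (phi r - phi s))).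
Proof.
case=> Gt Gp; split=> [|x x0].
  apply/matrixP => r s; rewrite !mxE -{1}Gt mxE -(opprB (phi r)) cosN.
  by [].
pose c : 'rV[R]_n := \row_r (x 0 r * cos (phi r)).
pose d : 'rV[R]_n := \row_r (x 0 r * sin (phi r)).
have quad (M : 'M[R]_n) (v : 'rV[R]_n) :
    (v *m M *m v^T) 0 0 = \sum_s \sum_r v 0 r * M r s * v 0 s.
  rewrite mxE; apply: eq_bigr => s _; rewrite mxE mulr_suml.
  by apply: eq_bigr => r _; rewrite [v^T s 0]mxE.
have -> : (x *m (\matrix_(r, s) (G r s * cos (phi r - phi s))) *m x^T) 0 0
    = (c *m G *m c^T) 0 0 + (d *m G *m d^T) 0 0.
  rewrite !quad -big_split; apply: eq_bigr => s _; rewrite -big_split.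
  by apply: eq_bigr => r _; rewrite !mxE cosB /=; ring.
have quad_ge0 (v : 'rV[R]_n) : 0 <= (v *m G *m v^T) 0 0.
  by have [->|/Gp/ltW//] := eqVneq v 0; rewrite !mul0mx mxE.
have [c0|/Gp cpos] := eqVneq c 0; last exact: ltr_pwDl.
apply: ltr_wpDl => //; apply: Gp; apply: contra x0 => /eqP d0.
apply/eqP/rowP => r; rewrite mxE.
move/rowP: c0 => /(_ r); move/rowP: d0 => /(_ r); rewrite !mxE => s0 c0.
apply/eqP; rewrite -sqrf_eq0 -[_ ^+ _]mulr1 -(cos2Dsin2 (phi r)).
by rewrite mulrDr -!exprMn c0 s0 expr0n addr0.
Qed.

Lemma ReZMZ (R : realType) (a b : R) (z : R[i]) :
  complex.Re (a%:C * z * b%:C) = a * b * complex.Re z.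
Proof. by case: z => x y /=; ring. Qed.

Lemma ler_norm_ReB (R : realType) (z w : R[i]) :
  `|complex.Re z - complex.Re w| <= ComplexField.Normc.normc (z - w).
Proof.
case: z w => [x y] [x' y'] /=.
by rewrite -sqrtr_sqr ler_wsqrtr // lerDl sqr_ge0.
Qed.

Lemma normc_le_csup_norm (R : realType) m n (M : 'M[R[i]]_(m, n)) r s :
  ComplexField.Normc.normc (M r s) <= csup_norm M.
Proof.
rewrite /csup_norm [leRHS]/Num.norm /= mx_normrE.
apply: le_trans (le_bigmax _ _ (r, s)); rewrite /= mxE.
exact: ler_norm.
Qed.

(** Exact for every estimate [fn]: the frequencies are split into their geometric
mean [exp Lbar] and the centered part. *)
Lemma Ghat_tilted_mean (R : realType) q n m (fn : R -> 'M[R[i]]_q)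
    (d0 d : 'rV[R]_q) :
    (0 < n)%N ->
  let lam (j : 'I_m) : R := fourier_freq n j.+1 in
  let Lbar := m%:R^-1 * \sum_j ln (lam j) in
  let V j := \matrix_(r, s)
    (lam j `^ (d0 0 r + d0 0 s) * complex.Re (fn (lam j) r s)) in
  Ghat n m fn d = \matrix_(r, s)
    (expR ((d - d0) 0 r * Lbar) *
     tilted_mean (fun j => ln (lam j) - Lbar) V (d - d0) r s *
     expR ((d - d0) 0 s * Lbar)).
Proof.
move=> n0 lam Lbar V; clearbody Lbar; apply/matrixP => r s.
rewrite /Ghat big_add1 big_mkord !mxE summxE card_ord mulrCA.
rewrite -[RHS]mulrA; congr (_ * _); rewrite mulr_sumr mulr_suml.
apply: eq_bigr => j _; have lam0 : lam j != 0.
  by rewrite gt_eqF // divr_gt0 ?mulr_gt0 ?pi_gt0 ?ltr0n.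
rewrite mxE /freq_diag mul_mx_diag mul_diag_mx !mxE.
rewrite ReZMZ -!/(lam j) /powR (negbTE lam0); set l := ln _; set x := complex.Re _.
have -> : expR (d 0 r * l) * expR (d 0 s * l) =
    expR ((d 0 r - d0 0 r) * Lbar) *
    expR ((d 0 r - d0 0 r + (d 0 s - d0 0 s)) * (l - Lbar)) *
    expR ((d0 0 r + d0 0 s) * l) * expR ((d 0 s - d0 0 s) * Lbar).
  by rewrite -!expRD; congr expR; ring.
by ring.
Qed.

(** The linear term of the objective cancels the scaling by the geometric mean of
the frequencies, so minimizing the objective amounts to minimizing the
continuous positive function [T], which separates [d0] from distant points. *)
Lemma objective_potential (R : realType) q (W : 'M[R]_q) (d0 : 'rV[R]_q)
    (e : R) :
    sym_posdef W -> 0 < e ->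
  exists2 eta : R, 0 < eta & forall n m (fn : R -> 'M[R[i]]_q),
    (0 < n)%N -> (1 < m)%N ->
    (forall (j : 'I_m) r s,
       `|fourier_freq n j.+1 `^ (d0 0 r + d0 0 s)
           * complex.Re (fn (fourier_freq n j.+1) r s) - W r s| <= eta) ->
    exists (T : 'rV[R]_q -> R) (c : R),
      [/\ continuous T, forall d, 0 < T d,
          forall d, objective n m fn d = ln (T d) - c &
          forall (d : 'rV[R]_q) r, e <= `|d 0 r - d0 0 r| -> T d0 < T d].
Proof.
move=> Wp e0; have [eta eta0 etaP] := tilted_mean_det_separation Wp e0.
exists eta => // n m fn n0 m1 fnW.
pose lam (j : 'I_m) : R := fourier_freq n j.+1.
pose Lbar := m%:R^-1 * \sum_j ln (lam j).
pose V j : 'M[R]_q := \matrix_(r, s)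
    (lam j `^ (d0 0 r + d0 0 s) * complex.Re (fn (lam j) r s)).
pose z j := ln (lam j) - Lbar.
have m0 : m%:R != 0 :> R by rewrite pnatr_eq0; lia.
have lamE j : lam j = 2 * pi / n%:R * j.+1%:R.
  by rewrite /lam /fourier_freq mulrAC.
have [|U [UJ Uz]] := @log_spread R m (2 * pi / n%:R) m1.
  by rewrite divr_gt0 ?mulr_gt0 ?pi_gt0 ?ltr0n.
have [|||j jU||T0 T1] := etaP 'I_m z U V.
- by rewrite card_ord; lia.
- rewrite /z sumrB sumr_const card_ord -[_ *+ _]mulr_natl /Lbar mulrA mulfV //.
  by rewrite mul1r subrr.
- by rewrite card_ord.
- rewrite /z /Lbar lamE; under eq_bigr do rewrite lamE.
  exact: Uz.
- by move=> j r s; rewrite mxE; exact: fnW.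
exists (fun d => \det (tilted_mean z V (d - d0))).
exists (2 * Lbar * \sum_r d0 0 r); split=> //.
- move=> d; apply: (@continuous_comp _ _ _ (fun x : 'rV[R]_q => x - d0)
    (fun x => \det (tilted_mean z V x))); last exact: continuous_tilted_mean_det.
  by apply: (@cvgB _ _ _ (nbhs d)); [exact: cvg_id|exact: cvg_cst].
- move=> d; rewrite /objective (Ghat_tilted_mean m fn d0 d n0) -/lam -/Lbar.
  rewrite det_congruence lnM ?posrE ?exprn_gt0 ?prodr_gt0 //; last first.
    by move=> r _; exact: expR_gt0.
  rewrite -expR_sum -expRM_natl expRK big_add1 big_mkord -/Lbar.
  rewrite -!mulr_suml.
  have -> : \sum_r (d - d0) 0 r = \sum_r d 0 r - \sum_r d0 0 r.
    by rewrite -sumrB; apply: eq_bigr => r _; rewrite !mxE.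
  by ring.
- move=> d r dr; rewrite subrr; apply: (T1 _ r).
  by rewrite !mxE.
Qed.

(** * Existence and location of minimizers *)

(** The parameter set is not closed at [-1/2]; the radius [e] keeps the
neighbourhood of [d0] away from that boundary. *)
Lemma Omega_near_compact (R : realType) q beta (B : set 'rV[R]_q) (d0 : 'rV[R]_q)
    (e : R) :
    closed B -> (forall i, e < d0 0 i + 1 / 2) ->
  compact (Omega beta B `&` [set d : 'rV[R]_q | forall i, `|d 0 i - d0 0 i| <= e]).
Proof.
move=> Bc ed0.
pose lo i := Num.max (- (beta / 2)) (d0 0 i - e).
pose hi i := Num.min 0 (d0 0 i + e).
have -> : Omega beta B `&` [set d : 'rV[R]_q | forall i, `|d 0 i - d0 0 i| <= e] =
    [set d : 'rV[R]_q | forall i, `[lo i, hi i]%classic (d ord0 i)] `&` B.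
  apply/seteqP; split=> d.
    case=> -[[h1 h2] Bd] h3; split=> // i /=; rewrite in_itv /= ge_max le_min.
    have := h1 i; have := h3 i; rewrite ler_norml; move=> /andP[a b] /andP[-> ->] /=.
    by apply/andP; split; lra.
  case=> h Bd; have {}h i : - (beta / 2) <= d 0 i <= 0 /\ `|d 0 i - d0 0 i| <= e.
    have := h i; rewrite /= in_itv /= ge_max le_min.
    move=> /andP[/andP[-> ?] /andP[-> ?]]; split=> //.
    by rewrite ler_norml; apply/andP; split; lra.
  split; last by move=> i; have [] := h i.
  split=> //; split=> i; have [/andP[ha hb] hc] := h i; first by rewrite ha.
  rewrite hb andbT; move: hc; rewrite ler_norml => /andP[hc _].
  by have := ed0 i; lra.
apply: compact_closedI => //.
apply: (rV_compact (A := fun i => `[lo i, hi i]%classic)).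
by move=> i; exact: segment_compact.
Qed.

(** Points of [D] far from [d0] are worse than [d0], so a minimum over the compact
part of [D] near [d0] is a minimum over [D]. *)
Lemma argmin_near (R : realType) q (T S : 'rV[R]_q -> R) (c : R)
    (D : set 'rV[R]_q) (d0 : 'rV[R]_q) (e : R) :
    continuous T -> (forall d, 0 < T d) -> (forall d, S d = ln (T d) - c) ->
    (forall (d : 'rV[R]_q) r, e <= `|d 0 r - d0 0 r| -> T d0 < T d) ->
    0 <= e -> D d0 ->
    compact (D `&` [set d : 'rV[R]_q | forall i, `|d 0 i - d0 0 i| <= e]) ->
  argmin S D !=set0 /\ forall d, argmin S D d -> forall i, `|d 0 i - d0 0 i| <= e.
Proof.
move=> Tc T0 ST far e0 Dd0 Kc; split; last first.
  move=> d [Dd /(_ _ Dd0)]; rewrite !ST lerD2r ler_ln ?posrE // => Sd i.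
  by rewrite leNgt; apply/negP => /ltW /far; rewrite ltNge Sd.
have Kd0 : (D `&` [set d : 'rV[R]_q | forall i, `|d 0 i - d0 0 i| <= e]) d0.
  by split=> // i; rewrite subrr normr0.
have [||d + dmin] := compact_EVT_min _ Kc (f := T).
- by exists d0.
- exact: continuous_subspaceT.
rewrite inE => -[Dd _]; exists d; split=> // d' Dd'.
rewrite !ST lerD2r ler_ln ?posrE //.
have [near|] := pselect (forall i, `|d' 0 i - d0 0 i| <= e).
  by apply: dmin; rewrite inE.
move=> /existsNP[i /negP]; rewrite -ltNge => /ltW /far Td'.
by apply: le_trans (ltW Td'); apply: dmin; rewrite inE.
Qed.

(** * The matrices at the Fourier frequencies *)

Lemma spectrum_near0 (R : realType) q (f : R -> 'M[R[i]]_q) (G0 : 'M[R]_q)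
    (d0 : 'rV[R]_q) (e : R) : 0 < e -> assumption_A1 f G0 d0 ->
  exists2 delta : R, 0 < delta & forall l, 0 < l < delta -> forall r s,
    `|l `^ (d0 0 r + d0 0 s) * complex.Re (f l r s)
      - G0 r s * cos (pi * d0 0 r / 2 - pi * d0 0 s / 2)| <= e.
Proof.
move=> e0 [_ fG].
pose good r s (l : R) := `|l `^ (d0 0 r + d0 0 s) * complex.Re (f l r s)
  - G0 r s * cos (pi * d0 0 r / 2 - pi * d0 0 s / 2)| <= e.
have : \forall l \near (0 : R)^'+, forall r s, good r s l.
  apply: filter_forall => r; apply: filter_forall => s.
  have /eqoP/(_ e e0) := fG r s; rewrite near_withinE => fGrs.
  rewrite near_withinE; apply: filterS fGrs => l fl l0; move: (fl l0) => {fl} /=.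
  have lne : l != 0 by rewrite gt_eqF.
  set a := d0 0 r; set b := d0 0 s; set g := G0 r s.
  rewrite [`|l `^ _|]ger0_norm ?powR_ge0 // => h.
  have pow0 : 0 < l `^ (a + b) by rewrite powR_gt0.
  have powV : l `^ (a + b) * l `^ (- a - b) = 1.
    by rewrite -powRD ?lne ?implybT // -opprD subrr powRr0.
  have reE : complex.Re (cexpi (pi * (a - b) / 2) * (g * l `^ (- a - b))%:C) =
      cos (pi * a / 2 - pi * b / 2) * (g * l `^ (- a - b)).
    by rewrite /cexpi /= mulr0 subr0; congr (cos _ * _); field.
  have {}h := le_trans (ler_norm _) h; have {h} := le_trans (ler_norm_ReB _ _) h.
  rewrite reE -(ler_pM2l pow0) -[in leLHS](gtr0_norm pow0) -normrM.
  set u := complex.Re _; set k := cos _; rewrite [X in _ <= X]mulrCA powV mulr1.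
  have -> : l `^ (a + b) * (u - k * (g * l `^ (- a - b))) =
      l `^ (a + b) * u - g * k * (l `^ (a + b) * l `^ (- a - b)) by ring.
  by rewrite powV mulr1.
move=> /nbhs_ballP[delta /= delta0 H]; exists delta => // l /andP[l0 ld].
by apply: H => //=; rewrite /ball /= sub0r normrN gtr0_norm.
Qed.

Lemma fourier_freq_small (R : realType) (m : nat -> nat) (delta : R) :
    assumption_A4 (R := R) m -> 0 < delta ->
  \forall n \near \oo, [/\ (0 < n)%N, (1 < m n)%N &
    forall j : 'I_(m n), n%:R^-1 <= fourier_freq n j.+1 :> R /\
                         fourier_freq n j.+1 < delta].
Proof.
case=> mpos mlim delta0.
pose e : R := Num.min (1 / 2) (delta / (2 * pi)).
have pi0 : 0 < pi :> R := pi_gt0 R.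
have e0 : 0 < e by rewrite lt_min !divr_gt0 // mulr_gt0.
have := @cvgr0_norm_lt _ _ _ _ _ _ mlim e e0.
move=> small; near=> n.
have n0 : (0 < n)%N by near: n; exact: nbhs_infty_gt.
have m0 : (0 < m n)%N by near: n.
have sn : `|(m n)%:R^-1 + (m n)%:R / n%:R| < e by near: n; exact: small.
have nR : 0 < n%:R :> R by rewrite ltr0n.
have mR : 0 < (m n)%:R :> R by rewrite ltr0n.
have mV : 0 < (m n)%:R^-1 :> R by rewrite invr_gt0.
have mn : 0 < (m n)%:R / n%:R :> R by rewrite divr_gt0.
rewrite gtr0_norm ?addr_gt0 // lt_min in sn; have /andP[s1 s2] := sn.
split=> //.
  rewrite ltnNge; apply/negP => m1; have /eqP m1' : m n == 1%N by lia.
  by rewrite m1' invr1 in s1; have := mn; rewrite m1'; lra.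
move=> j; rewrite /fourier_freq; split.
  rewrite -[leLHS]mul1r ler_pM2r ?invr_gt0 //.
  have : 1 <= (j.+1%:R : R) by rewrite ler1n.
  by have := pi_ge2 R; nra.
have : 2 * pi * j.+1%:R / n%:R <= 2 * pi * ((m n)%:R / n%:R) :> R.
  by rewrite mulrA ler_pM2r ?invr_gt0 // ler_pM2l ?mulr_gt0 // ler_nat.
move=> /le_lt_trans; apply.
rewrite mulrC -ltr_pdivlMr ?mulr_gt0 //; lra.
Unshelve. all: by end_near. Qed.

(** The Fourier frequencies are at least [n^-1], so an error of order
[n `^ (- beta)] stays small when multiplied by the factor [l `^ a], which is
unbounded at the origin. *)
Lemma powR_le_rate (R : realType) (n : nat) (a beta l : R) : (0 < n)%N ->
  - beta <= a <= 0 -> n%:R^-1 <= l -> l `^ a <= n%:R `^ beta.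
Proof.
move=> n0 /andP[ab a0] nl; have n1 : 1 <= n%:R :> R by rewrite ler1n.
have nR : 0 < n%:R :> R by lra.
have l0 : 0 < l by apply: lt_le_trans nl; rewrite invr_gt0.
have lnn : 0 <= ln (n%:R : R) by rewrite ln_ge0.
have lnl : - ln n%:R <= ln l.
  by rewrite -lnV ?posrE // ler_ln ?posrE ?invr_gt0.
by rewrite /powR !gt_eqF // ler_expR; nra.
Qed.

(** * Consistency *)

Theorem theorem3p1 (disp : measure_display) (T : measurableType disp)
    (R : realType) (P : probability T R) (q : nat)
    (X : nat -> 'I_q -> {RV P >-> R}) (f : R -> 'M[R[i]]_q)
    (d0 : 'rV[R]_q) (G0 : 'M[R]_q)
    (A : nat -> 'M[R]_q) (eps : int -> 'I_q -> {RV P >-> R})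
    (m : nat -> nat) (beta : R) (B : set 'rV[R]_q)
    (fhat : forall n : nat, 'M[R]_(n, q) -> R -> 'M[R[i]]_q)
    (dhat : nat -> T -> 'rV[R]_q) :
  weakly_stationary X ->
  spectral_density X f ->
  0 <= beta <= 1 ->
  closed B ->
  (B d0 ->
   rate_consistent P beta f (fun n w => fhat n (sample X n w))) ->
  assumption_A1 f G0 d0 ->
  assumption_A2 X A eps ->
  assumption_A3 A ->
  assumption_A4 (R := R) m ->
  Omega beta B d0 ->
  (forall n w,
     let S := objective n (m n) (fhat n (sample X n w)) in
     argmin S (Omega beta B) !=set0 ->
     argmin S (Omega beta B) (dhat n w)) ->
  cvg_in_probability P dhat d0.
Proof.
move=> _ _ _ Bc fhatP A1 _ _ A4 Od0 dhatP e e0.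
have [[Ob0 Oh0] Bd0] := Od0.
(* a radius below e that keeps the e1-box around d0 inside ]-1/2, +oo[ *)
pose e1 : R := \big[Num.min/e]_(i < q) ((d0 0 i + 1 / 2) / 2).
have e10 : 0 < e1.
  by apply: lt_bigmin => // i _; have /andP[? _] := Oh0 i; lra.
have e1e : e1 <= e by rewrite /e1 bigmin_idl ge_min lexx.
have e1d i : e1 < d0 0 i + 1 / 2.
  have : e1 <= (d0 0 i + 1 / 2) / 2 by apply: bigmin_le.
  by have /andP[? _] := Oh0 i; lra.
pose W : 'M[R]_q :=
  \matrix_(r, s) (G0 r s * cos (pi * d0 0 r / 2 - pi * d0 0 s / 2)).
have Wp : sym_posdef W.
  by have [Gp _] := A1; apply: (sym_posdef_phase (fun r => pi * d0 0 r / 2) Gp).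
have [eta eta0 pot] := objective_potential d0 Wp e10.
have eta2 : 0 < eta / 2 by rewrite divr_gt0.
have [delta delta0 fnear] := spectrum_near0 eta2 A1.
have dpi : 0 < Num.min delta pi by rewrite lt_min delta0 pi_gt0.
apply: (squeeze_cvge _ (@cvg_cst _ _ _ _ _) (fhatP Bd0 _ eta2)).
near=> n; rewrite mu_ext_ge0 /=; last exact: measure_ge0.
apply: (le_mu_ext P) => w /= far.
have [n0 m1 freq] : [/\ (0 < n)%N, (1 < m n)%N &
    forall j : 'I_(m n), n%:R^-1 <= fourier_freq n j.+1 :> R /\
                         fourier_freq n j.+1 < Num.min delta pi].
  by near: n; exact: fourier_freq_small.
(* otherwise the estimate is good at every frequency, and dhat is near d0 *)
apply: contrapT => good.
set fn := fhat n (sample X n w) in good.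
have [|T' [c [Tc T0 ST Tfar]]] := pot n (m n) fn n0 m1.
  move=> j r s; have [lnj] := freq j; set l := fourier_freq n j.+1 in lnj *.
  rewrite lt_min => /andP[ld lpi].
  have l0 : 0 < l by apply: lt_le_trans lnj; rewrite invr_gt0 ltr0n.
  set p := l `^ _; set u := complex.Re _.
  have h1 := fnear l _ r s; rewrite l0 ld -/p in h1; have {}h1 := h1 isT.
  set v := complex.Re (f l r s) in h1.
  have h2 : p * `|u - v| <= eta / 2.
    have h3 : n%:R `^ beta * csup_norm (fn l - f l) <= eta / 2.
      rewrite leNgt; apply/negP => bad; apply: good; exists l => //.
      by rewrite l0 ltW.
    apply: le_trans h3; apply: ler_pM => //; first exact: powR_ge0.
      apply: powR_le_rate lnj => //.
      by have /andP[? ?] := Ob0 r; have /andP[? ?] := Ob0 s; apply/andP; split; lra.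
    apply: le_trans (ler_norm_ReB _ _) _.
    have := normc_le_csup_norm (fn l - f l) r s.
    by rewrite !mxE.
  have -> : p * u - W r s = p * (u - v) + (p * v - W r s) by ring.
  apply: le_trans (ler_normD _ _) _; rewrite normrM ger0_norm ?powR_ge0 //.
  by rewrite [W r s]mxE; lra.
have [argn argP] := argmin_near Tc T0 ST Tfar (ltW e10) Od0
  (Omega_near_compact Bc e1d).
have near_d := argP _ (dhatP n w argn).
move: far; rewrite ltNge => /negP; apply.
rewrite [leLHS]/Num.norm /= mx_normrE; apply: bigmax_le; first exact: ltW.
move=> [i j] _ /=; rewrite !mxE; rewrite (ord1 i).
exact: le_trans (near_d j) e1e.
Unshelve. all: by end_near. Qed.
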